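(* For each real $\alpha\in[0,1]$ we have $f\left(n,\lfloor n^\alpha\rfloor+12\right)\in O\left(n^{2-2\alpha}\right)$, i.e. there is a constant $C>0$ (which may depend on $\alpha$) and $n_0\in\mathbb{N}$ such that $f\left(n,\lfloor n^\alpha\rfloor+12\right)\le C\,n^{2-2\alpha}$ for all integers $n\ge n_0$.
   Context: One-dimensional Hegselmann--Krause (HK) system with strategic agents: there is a set $N=\{1,\dots,n\}$ of non-strategic agents and a disjoint set $S$ of $m=|S|$ strategic agents; $A=N\cup S$. At each discrete time $t\in\mathbb{N}_{\ge 0}$ every agent $i\in A$ has an opinion $x_i(t)\in\mathbb{R}$. The starting opinions $x_i(0)$, $i\in N$, are given. The opinions $x_s(t)$ of the strategic agents $s\in S$ can be chosen freely (as any real numbers) at every time $t$. For $i\in N$, $$x_i(t+1)=\frac{1}{|\mathcal{N}_i(t)|}\sum_{j\in\mathcal{N}_i(t)}x_j(t),\qquad \mathcal{N}_i(t)=\{j\in A: |x_i(t)-x_j(t)|\le 1\}.$$ The system has converged at time $t$ if for all $i,j\in N$ either $x_i(t)=x_j(t)$ or $|x_i(t)-x_j(t)|>1$. The convergence time is the smallest $t\in\mathbb{N}_{\ge 0}$ such that the system has converged at time $t$. For given starting opinions of the non-strategic agents and given $m$, the optimal convergence time is the minimum of the convergence time over all choices of the opinions of the $m$ strategic agents at all times. $f(n,m)$ denotes the supremum of the optimal convergence time over all starting opinions of $n$ non-strategic agents, with $m$ strategic agents. *)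

(* Defs.v *)
From HB Require Import structures.
From mathcomp Require Import all_boot all_order all_algebra.
From mathcomp Require Import all_classical all_reals all_analysis.

Set Implicit Arguments.
Unset Strict Implicit.
Unset Printing Implicit Defensive.

Import Order.TTheory GRing.Theory Num.Theory.

Local Open Scope classical_set_scope.
Local Open Scope ring_scope.

Section HegselmannKrause.
Variables (R : realType) (n m : nat).

(* [inl i] is a non-strategic agent, [inr s] a strategic one. *)
Definition agent : finType := ('I_n + 'I_m)%type.

Definition opinions (x : 'I_n -> R) (y : 'I_m -> R) (a : agent) : R :=
  match a with inl i => x i | inr s => y s end.

Definition neighbours (x : 'I_n -> R) (y : 'I_m -> R) (i : 'I_n) :
    {set agent} :=
  [set j : agent | `|x i - opinions x y j| <= 1]%SET.

Definition hk_step (x : 'I_n -> R) (y : 'I_m -> R) (i : 'I_n) : R :=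
  #|neighbours x y i|%:R^-1 * \sum_(j in neighbours x y i) opinions x y j.

(* The dynamics is deterministic, so choosing the strategic opinions freely at
   every time, possibly in reaction to the past, amounts to choosing a whole
   trajectory [y] in advance. *)
Fixpoint hk (x0 : 'I_n -> R) (y : nat -> 'I_m -> R) (t : nat) : 'I_n -> R :=
  match t with
  | 0%N => x0
  | t'.+1 => hk_step (hk x0 y t') (y t')
  end.

Definition converged (x : 'I_n -> R) : Prop :=
  forall i j : 'I_n, x i = x j \/ 1 < `|x i - x j|.

(* Times are natural numbers or [+oo] (no convergence), embedded in [\bar R].
   An infimum of a set of such values is its minimum, or [+oo] if it is
   empty. *)
Definition convergence_time (x0 : 'I_n -> R) (y : nat -> 'I_m -> R) : \bar R :=
  ereal_inf [set t%:R%:E | t in [set t : nat | converged (hk x0 y t)]].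

Definition optimal_convergence_time (x0 : 'I_n -> R) : \bar R :=
  ereal_inf [set convergence_time x0 y | y in [set: nat -> 'I_m -> R]].

Definition f : \bar R :=
  ereal_sup [set optimal_convergence_time x0 | x0 in [set: 'I_n -> R]].

End HegselmannKrause.

Arguments f R n m : clear implicits.

(* Main.v *)
(* Cut the line into unit cells and keep only the occupied ones, at most n of
   them. Put W ~ 6n/m and group the occupied cells four by four into
   supercells. Some residue class mod W of supercells holds at most m/6 agents
   in total. In one step, every contiguous supercell of that class is split in
   its middle: three strategic agents per local agent pull to the left, three
   to the right, and this suffices to open a gap larger than 1. (In a
   non-contiguous supercell, an empty cell already provides the gap.) The
   result is a set of pieces which never interact again; pieces are grouped in
   at most m/2 blocks of O(W) cells, and a block of k agents receives at least
   k m/(2n) strategic agents, and at least one. Placed at distance 1 from the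
   left end of a piece of length > 1, these increase its left end by at least
   m/(m+2n) per step. So O(W(1 + n/m)) = O((n/m)^2) steps shrink every piece to
   length <= 1, and one more step collapses it to a point. *)

Require Import Defs.
From mathcomp Require Import all_boot all_order all_algebra.
From mathcomp Require Import all_classical all_reals all_analysis.
From mathcomp Require Import zify ring lra.

Set Implicit Arguments.
Unset Strict Implicit.
Unset Printing Implicit Defensive.

Import Order.TTheory GRing.Theory Num.Theory.

Local Open Scope ring_scope.

(** * Averages over a neighbourhood, measured from a threshold *)

Section Averaging.
Variables (R : realType) (n m : nat).
Implicit Types (x : 'I_n -> R) (y : 'I_m -> R) (i : 'I_n) (c : R).

Lemma neighboursE x y i (j : agent n m) :
  (j \in neighbours x y i) = (x i - 1 <= opinions x y j <= x i + 1).
Proof. by rewrite inE ler_norml; apply/andP/andP => -[]; lra. Qed.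

Lemma card_neighbours_gt0 x y i : (0 < #|neighbours x y i|)%N.
Proof.
by apply/card_gt0P; exists (inl i); rewrite inE /= subrr normr0.
Qed.

Lemma hk_stepB x y i c : hk_step x y i - c =
  #|neighbours x y i|%:R^-1 * \sum_(j in neighbours x y i) (opinions x y j - c).
Proof.
have N0 : #|neighbours x y i|%:R != 0 :> R.
  by rewrite pnatr_eq0 -lt0n card_neighbours_gt0.
by rewrite sumrB sumr_const -(mulr_natl c) mulrBr mulKf.
Qed.

Lemma hk_step_le_sum x y i c :
  \sum_(j in neighbours x y i) (opinions x y j - c) <= 0 -> hk_step x y i <= c.
Proof. by move=> S0; rewrite -subr_le0 hk_stepB mulr_ge0_le0 ?invr_ge0. Qed.

Lemma hk_step_ge_sum x y i c :
  0 <= \sum_(j in neighbours x y i) (opinions x y j - c) -> c <= hk_step x y i.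
Proof. by move=> S0; rewrite -subr_ge0 hk_stepB mulr_ge0 ?invr_ge0. Qed.

Lemma hk_step_le x y i c :
  (forall j, j \in neighbours x y i -> opinions x y j <= c) ->
  hk_step x y i <= c.
Proof.
move=> lec; apply: hk_step_le_sum; apply: sumr_le0 => j /lec.
by rewrite subr_le0.
Qed.

Lemma hk_step_ge x y i c :
  (forall j, j \in neighbours x y i -> c <= opinions x y j) ->
  c <= hk_step x y i.
Proof.
move=> gec; apply: hk_step_ge_sum; apply: sumr_ge0 => j /gec.
by rewrite subr_ge0.
Qed.

Lemma hk_step_lt x y i c :
  (forall j, j \in neighbours x y i -> opinions x y j < c) ->
  hk_step x y i < c.
Proof.
move=> ltc; rewrite -subr_lt0 hk_stepB pmulr_rlt0; last first.
  by rewrite invr_gt0 ltr0n card_neighbours_gt0.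
have iN : inl i \in neighbours x y i by rewrite inE /= subrr normr0.
rewrite (bigD1 (inl i)) //= ltr_wnDr //; last by rewrite subr_lt0 (ltc (inl i)).
by apply: sumr_le0 => j /andP[/ltc]; rewrite subr_le0 => /ltW.
Qed.

Lemma eq_hk_step x y i k :
  neighbours x y i = neighbours x y k -> hk_step x y i = hk_step x y k.
Proof. by rewrite /hk_step => ->. Qed.

Lemma hkS x (ys : nat -> 'I_m -> R) t :
  hk x ys t.+1 = hk (hk_step x (ys 0%N)) (fun u => ys u.+1) t.
Proof. by elim: t => //= t ->. Qed.

End Averaging.

(** List [d j] copies of each [j] in a row and give slot [s] the entry [s], or [None] past the end.
    Both distributions of strategic agents come from this. *)
Lemma assignment (J : finType) (d : J -> nat) (m : nat) :
  (\sum_j d j <= m)%N ->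
  exists g : 'I_m -> option J, forall j, (d j <= #|[set s | g s == Some j]|)%N.
Proof.
move=> dm; pose l := flatten [seq nseq (d j) j | j <- enum J].
have sz : size l = (\sum_j d j)%N.
  rewrite size_flatten /shape -map_comp sumnE big_map big_enum /=.
  by apply: eq_bigr => j _; rewrite size_nseq.
exists (fun s => nth None (map some l) s) => j.
have cnt : count_mem j l = d j.
  rewrite count_flatten -map_comp sumnE big_map big_enum /= (bigD1 j) //=.
  rewrite count_nseq /= eqxx mul1n big1 ?addn0 // => k /negbTE kj.
  by rewrite count_nseq /= kj.
have -> : #|[set s : 'I_m | nth None (map some l) s == Some j]| =
    (\sum_(s < m) (nth None (map some l) s == Some j))%N.
  rewrite -sum1_card big_mkcond; apply: eq_bigr => s _.
  by rewrite inE; case: eqP.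
rewrite -{1}cnt -sum1_count big_mkcond /= (big_nth j) sz.
rewrite -(big_mkord xpredT
  (fun s => (nth None (map some l) s == Some j : nat))).
rewrite (big_cat_nat (leq0n _) dm) /= -[leqLHS]addn0 leq_add //.
rewrite big_nat [leqRHS]big_nat leq_sum // => s /andP[_ sl].
by rewrite (nth_map j) ?sz //; case: eqP => [->|]; rewrite ?eqxx.
Qed.

(** * Shrinking separated pieces from the left *)

Section Contraction.
Variables (R : realType) (n m K : nat) (B : finType).
Variables (lab : 'I_n -> 'I_K) (blk : 'I_K -> B) (asg : 'I_m -> option B).
Variables (U : 'I_K -> R) (far sigma : R).
Implicit Types (x : 'I_n -> R) (L : 'I_K -> R) (w : B).

Definition used (b : 'I_K) : bool := [exists i, lab i == b].

(** Half-open, so that a gap of exactly 1 between hulls keeps their agents more than 1 apart. *)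
Definition in_hulls L x : Prop := forall i, L (lab i) <= x i < U (lab i).

Definition separated L : Prop :=
  forall i j, (lab i < lab j)%N -> U (lab i) + 1 <= L (lab j).

(** A block serves one long piece at a time, with all its strategic agents together. *)
Definition active L w : option 'I_K :=
  [pick b | [&& used b, blk b == w & 1 < U b - L b]].

Definition place L (s : 'I_m) : R :=
  if asg s is Some w then if active L w is Some b then L b + 1 else far
  else far.

Definition advance L (b : 'I_K) : R :=
  if active L (blk b) == Some b then L b + sigma else L b.

(** The potential of a block: it drops by [sigma] in each step in which the block is active. *)
Definition total_length L w : R :=
  \sum_(b | used b && (blk b == w)) (U b - L b).

Hypothesis far_away : forall i, U (lab i) + 1 <= far.
Hypothesis sigma_ge0 : 0 <= sigma.
Hypothesis speed : forall w,
  sigma * (#|[set i | blk (lab i) == w]| + #|[set s | asg s == Some w]|)%:R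
    <= #|[set s | asg s == Some w]|%:R.
Hypothesis occupied : forall i,
  (0 < #|[set s | asg s == Some (blk (lab i))]|)%N.

Lemma used_lab i : used (lab i).
Proof. by apply/existsP; exists i. Qed.

Lemma le_advance L b : L b <= advance L b.
Proof. by rewrite /advance; case: ifP => _; rewrite ?lerDl. Qed.

Lemma activeP L w b :
  active L w = Some b -> [/\ used b, blk b = w & 1 < U b - L b].
Proof.
by rewrite /active; case: pickP => // b' /and3P[? /eqP ? ?] [<-].
Qed.

Lemma active_advance L w : active L w = None -> active (advance L) w = None.
Proof.
rewrite /active; case: pickP => // noL _; case: pickP => // b.
case/and3P=> ub bw Ub; exfalso; move: (noL b).
rewrite ub bw /= => /negbT; rewrite -leNgt.
by have := le_advance L b; lra.
Qed.

Lemma agent_neighbour L x (y : 'I_m -> R) i j : in_hulls L x -> separated L ->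
  inl j \in neighbours x y i -> lab j = lab i.
Proof.
move=> xL sL; rewrite neighboursE /= => xij.
have xi := xL i; have xj := xL j.
by case: (ltngtP (lab i) (lab j)) => [/sL ?|/sL ?|/val_inj //]; exfalso; lra.
Qed.

(** An active piece is longer than 1, so the point [L b + 1] lies inside its hull and, by
    separation, out of sight of the other pieces. *)
Lemma strategic_neighbour L x s i : in_hulls L x -> separated L ->
  inr s \in neighbours x (place L) i ->
  [/\ active L (blk (lab i)) = Some (lab i), asg s = Some (blk (lab i))
    & place L s = L (lab i) + 1].
Proof.
move=> xL sL; rewrite neighboursE /= /place.
have xi := xL i; have fi := far_away i.
case E : (asg s) => [w|]; last by move=> ?; exfalso; lra.
case E' : (active L w) => [b|]; last by move=> ?; exfalso; lra.
have [/existsP[k /eqP kb] bw Ub] := activeP E'.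
rewrite -kb in Ub bw E' *.
move=> xs; case: (ltngtP (lab k) (lab i)) => [/sL ?|/sL ?|/val_inj ki].
- by exfalso; lra.
- by exfalso; lra.
- by rewrite -ki bw.
Qed.

(** Relative to the new lower end [L b + sigma] of an active piece, each strategic agent of the
    block contributes [1 - sigma] and each agent of the piece at least [- sigma]. By [speed] the sum
    is nonnegative even if the whole block is counted. *)
Lemma in_hulls_step L x : in_hulls L x -> separated L ->
  in_hulls (advance L) (hk_step x (place L)).
Proof.
move=> xL sL i; apply/andP; split; last first.
  apply: hk_step_lt => -[j|s].
    by move/(agent_neighbour xL sL) => /= <-; case/andP: (xL j).
  by case/(strategic_neighbour xL sL) => /activeP[_ _ ?] _ /= ->; lra.
rewrite /advance; case: eqP => [act|nact]; last first.
  apply: hk_step_ge => -[j|s].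
    by move/(agent_neighbour xL sL) => /= <-; case/andP: (xL j).
  by case/(strategic_neighbour xL sL).
set w := blk (lab i) in act *.
set N := #|[set j | blk (lab j) == w]|; set M := #|[set s | asg s == Some w]|.
have sp : sigma * (N + M)%:R <= M%:R := speed w.
have M0 : 0 < M%:R :> R by rewrite ltr0n; exact: occupied.
have sigma_le1 : sigma <= 1.
  rewrite -(ler_pM2r M0) mul1r (le_trans _ sp) // ler_wpM2l // ler_nat.
  exact: leq_addl.
(* Beyond [L + 2] the strategic agents are out of sight, but every neighbour exceeds [L + 1], hence
   [L + sigma]. *)
have [xi2|xi2] := lerP (x i) (L (lab i) + 2); last first.
  apply: hk_step_ge => -[j|s]; rewrite neighboursE => /andP[+ _]; lra.
apply: hk_step_ge_sum.
have Ms s : asg s = Some w -> place L s = L (lab i) + 1.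
  by rewrite /place => ->; rewrite act.
rewrite big_mkcond /= big_sumType /=; have s0 := sigma_ge0.
have S1 : - (sigma * N%:R) <= \sum_(j < n)
    (if inl j \in neighbours x (place L) i
     then x j - (L (lab i) + sigma) else 0).
  rewrite /N -sum1_card natr_sum mulr_sumr -sumrN big_mkcond /=.
  apply: ler_sum => j _; rewrite inE.
  case: (boolP (inl j \in _)) => [jN|_]; last by case: ifP => _; lra.
  have ji := agent_neighbour xL sL jN.
  by rewrite -/w ji eqxx mulr1 -ji; have := xL j; lra.
have S2 : M%:R * (1 - sigma) <= \sum_(s < m)
    (if inr s \in neighbours x (place L) i
     then place L s - (L (lab i) + sigma) else 0).
  rewrite /M -sum1_card natr_sum mulr_suml big_mkcond /= ler_sum // => s _.
  rewrite inE; case: ifP => [/eqP sw|/eqP nsw].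
    rewrite ifT; first by rewrite (Ms _ sw); lra.
    by rewrite neighboursE /= (Ms _ sw); have := xL i; lra.
  by case: ifP => // sN; case: (strategic_neighbour xL sL sN).
move: sp; rewrite natrD; lra.
Qed.

Lemma total_length_advance L w b : active L w = Some b ->
  total_length (advance L) w = total_length L w - sigma.
Proof.
move=> act; have [ub bw Ub] := activeP act.
rewrite /total_length (bigD1 b) /=; last by rewrite ub bw eqxx.
rewrite [in RHS](bigD1 b) /=; last by rewrite ub bw eqxx.
rewrite {1}/advance bw act eqxx (eq_bigr (fun c => U c - L c)); first by ring.
move=> c /andP[/andP[_ /eqP cw] cb]; rewrite /advance cw act.
by rewrite (inj_eq Some_inj) eq_sym (negbTE cb).
Qed.

Lemma separated_advance L : separated L -> separated (advance L).
Proof.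
by move=> sL i j /sL; have := le_advance L (lab j); lra.
Qed.

(** In a piece of length at most 1 every agent sees exactly that piece, so all compute the same
    average. *)
Lemma converged_inactive L x : in_hulls L x -> separated L ->
  (forall w, active L w = None) -> converged (hk_step x (place L)).
Proof.
move=> xL sL nact i j; have [lij|nlij] := eqVneq (lab i) (lab j).
  left; apply: eq_hk_step; apply/setP => -[k|s]; last first.
    by apply/idP/idP => /(strategic_neighbour xL sL)[]; rewrite nact.
  have len k' : U (lab k') - L (lab k') <= 1.
    move: (nact (blk (lab k'))); rewrite /active; case: pickP => // no _.
    by move: (no (lab k')); rewrite used_lab eqxx /= => /negbT; rewrite -leNgt.
  have same k' l : lab l = lab k' -> inl l \in neighbours x (place L) k'.
    move=> lk; rewrite neighboursE /=.
    have := xL l; have := xL k'; have := len k'; rewrite lk; lra.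
  by apply/idP/idP => /(agent_neighbour xL sL) lk; apply: same; rewrite lk.
have yL := in_hulls_step xL sL; have sL' := separated_advance sL.
right; have := yL i; have := yL j.
case: (ltngtP (lab i) (lab j)) => [/sL'|/sL'|/val_inj] h; first 2 last.
- by rewrite h eqxx in nlij.
- by rewrite distrC ltr_normr; lra.
- by rewrite ltr_normr; lra.
Qed.

(** A block still active at time [T] has lost [sigma * T], at least its whole length budget [F],
    although an active piece alone is longer than 1. The extra step collapses the short pieces. *)
Lemma contraction x L (F : R) (T : nat) :
  in_hulls L x -> separated L -> (forall w, total_length L w <= F) ->
  F <= sigma * T%:R -> exists ys : nat -> 'I_m -> R, converged (hk x ys T.+1).
Proof.
move=> xL sL LF FT; pose Lt t := iter t advance L.
pose ys t := place (Lt t); exists ys.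
have inv t : in_hulls (Lt t) (hk x ys t) /\ separated (Lt t).
  elim: t => [|t [IH1 IH2]] //=; split; first exact: in_hulls_step.
  exact: separated_advance.
have [xT sT] := inv T; apply: converged_inactive => // w.
case E : (active (Lt T) w) => [b|] //; exfalso.
have tot t : (t <= T)%N ->
    total_length (Lt t) w = total_length L w - sigma * t%:R.
  elim: t => [|t IH] tT; first by rewrite mulr0 subr0.
  (* Lower ends only increase, so an inactive block would still be inactive at time [T]. *)
  have act : active (Lt t) w <> None.
    move=> none; have : active (Lt T) w = None.
      rewrite -(subnK (ltnW tT)) addnC; elim: (T - t)%N => [|u IHu].
        by rewrite addn0.
      by rewrite addnS; exact: active_advance.
    by rewrite E.
  case A : (active (Lt t) w) => [c|] //.
  have -> : Lt t.+1 = advance (Lt t) by [].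
  rewrite (total_length_advance A) (IH (ltnW tT)) -addn1 natrD mulrDr mulr1.
  by rewrite opprD addrA.
have [ub bw Ub] := activeP E.
have : 1 < total_length (Lt T) w.
  rewrite /total_length (bigD1 b) /=; last by rewrite ub bw eqxx.
  rewrite (lt_le_trans Ub) // lerDl; apply: sumr_ge0 => c.
  by case/andP => /andP[/existsP[k /eqP <-] _ _]; have := xT k; lra.
by have := LF w; rewrite tot //; lra.
Qed.

End Contraction.

(** * Opening gaps in a single step *)

Section Splitting.
Variables (R : realType) (n m : nat) (x : 'I_n -> R).
Variables (e : nat -> R) (rho : 'I_n -> nat) (sel : pred nat).
Variables (g : 'I_m -> option ('I_n * bool)) (far : R).

(** [rho a] is the rank of the occupied cell of [a], and [e r] the left end of the cell of rank
    [r]. *)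
Definition supercell (a : 'I_n) : nat := (rho a %/ 4)%N.

Hypothesis e_step : forall r, e r.+1 = e r + 1 \/ e r + 2 <= e r.+1.
Hypothesis cell : forall i, e (rho i) <= x i < e (rho i) + 1.
Hypothesis far_away : forall i, x i + 1 < far.
Hypothesis demand : forall a side, sel (supercell a) ->
  (3 <= #|[set s | g s == Some (a, side)]|)%N.

(** Left ends of successive cells differ by at least 1, so the equality forces the four cells to be
    contiguous. *)
Definition act (h : nat) : bool := sel h && (e (4 * h + 3) == e (4 * h) + 3).

(* [puller_left h + 1] is the last agent before the cut [e (4 * h) + 2] (or
   [e (4 * h) + 1] if there is none in between); the point [e (4 * h) + 1]
   itself would also be seen by an agent sitting exactly at the cut. *)
Definition puller_left (h : nat) : R :=
  \big[Order.max/(e (4 * h) + 1)]_(i | x i < e (4 * h) + 2) x i - 1.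

Definition puller_right (h : nat) : R := e (4 * h) + 3.

Definition split_place (s : 'I_m) : R :=
  if g s is Some (a, side) then
    if act (supercell a) then
      if side then puller_right (supercell a) else puller_left (supercell a)
    else far
  else far.

Definition forced (r : nat) : bool := (r %% 4 == 2)%N && act (r %/ 4)%N.

(** The ranks at which a new piece starts. *)
Definition boundary (r : nat) : bool :=
  [|| r == 0%N, e r != e r.-1 + 1 | forced r].

(** Piece ends after the split: at a cut, both sides recede by 1/2 from [e r], which leaves a gap of
    1. *)
Definition lower_end (r : nat) : R :=
  if forced r then e r + 2^-1 else e r.

Definition upper_end (r : nat) : R :=
  if forced r then e r.-1 + 2^-1 else e r.-1 + 1.

Lemma cell_shift r k : e r + k%:R <= e (r + k).
Proof.
elim: k => [|k IH]; first by rewrite addr0 addn0.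
by rewrite addnS -addn1 natrD; case: (e_step (r + k)); lra.
Qed.

Lemma cell_mono r r' : (r <= r')%N -> e r <= e r'.
Proof.
move=> /subnKC <-; apply: le_trans (cell_shift _ _).
by rewrite lerDl.
Qed.

Lemma cell_lt r r' : (r < r')%N -> e r + 1 <= e r'.
Proof.
move=> /cell_mono; have := cell_shift r 1; rewrite addn1; lra.
Qed.

Lemma act_cells h : act h ->
  [/\ e (4 * h + 1) = e (4 * h) + 1, e (4 * h + 2) = e (4 * h) + 2
    & e (4 * h + 3) = e (4 * h) + 3].
Proof.
case/andP=> _ /eqP.
have := e_step (4 * h); have := e_step (4 * h + 1).
have := e_step (4 * h + 2); rewrite !addn1 !addn2 !addn3.
by move=> [?|?] [?|?] [?|?] ?; split; lra.
Qed.

Lemma puller_leftP h :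
  e (4 * h) <= puller_left h < e (4 * h) + 1 /\
  forall i, x i < e (4 * h) + 2 -> x i <= puller_left h + 1.
Proof.
rewrite /puller_left; set M := \big[_/_]_(_ | _) _; split; last first.
  by move=> i xi; rewrite subrK; exact: le_bigmax_cond.
have M1 : e (4 * h) + 1 <= M by exact: bigmax_ge_id.
have M2 : M < e (4 * h) + 2 by apply: bigmax_lt => //; lra.
lra.
Qed.

Lemma strategic_split_neighbour s i : inr s \in neighbours x split_place i ->
  exists a side, [/\ g s = Some (a, side), act (supercell a) & split_place s =
    if side then puller_right (supercell a) else puller_left (supercell a)].
Proof.
rewrite neighboursE /= {1 2}/split_place; have := far_away i.
case E : (g s) => [[a side]|]; last by move=> ? ?; exfalso; clear E; lra.
case: ifP => [aa|_]; last by move=> ? ?; exfalso; clear E; lra.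
by move=> _ _; exists a, side; rewrite /split_place E aa.
Qed.

(** Visible pullers sit in occupied cells too, so they never bridge an empty cell. *)
Lemma cell_of_neighbour i j : j \in neighbours x split_place i ->
  exists k, e k <= opinions x split_place j < e k + 1.
Proof.
case: j => [j _|s]; first by exists (rho j); exact: cell.
case/strategic_split_neighbour => a [side [_ aa /= ->]].
case: side.
  exists (4 * supercell a + 3)%N; rewrite /puller_right.
  by have [_ _ ->] := act_cells aa; lra.
by exists (4 * supercell a)%N; case: (puller_leftP (supercell a)).
Qed.

Lemma supercell_lt h h' : (h < h')%N -> e (4 * h + 3) + 1 <= e (4 * h').
Proof. by move=> hh'; apply: cell_lt; lia. Qed.

Lemma supercell_bounds j :
  e (4 * supercell j) <= x j < e (4 * supercell j + 3) + 1.
Proof.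
have := cell j.
have : e (4 * supercell j) <= e (rho j).
  by apply: cell_mono; rewrite /supercell; lia.
have : e (rho j) <= e (4 * supercell j + 3).
  by apply: cell_mono; rewrite /supercell; lia.
lra.
Qed.

Lemma supercell_puller h side : act h ->
  e (4 * h) <= (if side then puller_right h else puller_left h)
    < e (4 * h + 3) + 1.
Proof.
move=> ah; have [_ _ e3] := act_cells ah; have [p _] := puller_leftP h.
by rewrite /puller_right; case: side; lra.
Qed.

(* Measured from a threshold at distance 1/2 from the pullers, each agent of the
   supercell weighs at most 3/2 against the pull, and each puller 1/2 for it. *)
Lemma puller_balance h side : act h ->
  \sum_(a : 'I_n) (if supercell a == h then 3 / 2 else 0) -
  \sum_(s : 'I_m) (if [exists a, (g s == Some (a, side)) && (supercell a == h)]
                   then 2^-1 else 0) <= 0 :> R.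
Proof.
move=> /andP[sh _]; rewrite subr_le0.
have -> : \sum_(s : 'I_m)
    (if [exists a, (g s == Some (a, side)) && (supercell a == h)]
     then 2^-1 else 0) =
    \sum_(s : 'I_m) \sum_(a : 'I_n)
      (if (g s == Some (a, side)) && (supercell a == h) then 2^-1 else 0) :> R.
  apply: eq_bigr => s _; case: ifP => [/existsP[a Ha]|/negbT/existsPn no].
    rewrite (bigD1 a) //= Ha big1 ?addr0 // => b ba.
    case/andP: Ha => /eqP -> _.
    rewrite ifF //; apply/negbTE; rewrite negb_and; apply/orP; left.
    by apply: contraNN ba => /eqP[->].
  by rewrite big1 // => a _; rewrite (negbTE (no a)).
rewrite exchange_big /= ler_sum // => a _; case: eqP => [ah|_]; last first.
  by rewrite big1 // => s _; rewrite andbF.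
have := @demand a side; rewrite ah => /(_ sh) d.
under eq_bigr => s _ do rewrite andbT.
rewrite -big_mkcond /= sumr_const.
have -> : #|[pred s | g s == Some (a, side)]| =
    #|[set s | g s == Some (a, side)]|.
  by apply: eq_card => s; rewrite !inE.
have {d} : 3 <= #|[set s | g s == Some (a, side)]|%:R :> R.
  by rewrite (ler_nat R 3).
by rewrite -(mulr_natl 2^-1); lra.
Qed.

Lemma puller_of_supercell s h side (a : 'I_n) :
  act h -> g s = Some (a, side) -> supercell a = h ->
  split_place s = if side then puller_right h else puller_left h.
Proof. by move=> ah gs sa; rewrite /split_place gs sa ah. Qed.

(** The right pullers are seen by every agent from the cut up to [e (4 * h) + 4]; the left pullers
    of this supercell, below [e (4 * h) + 1], are not. Only agents of the supercell can weigh
    against the pull, so [puller_balance] decides. *)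
Lemma right_of_forced r i : forced r -> (r <= rho i)%N ->
  lower_end r <= hk_step x split_place i.
Proof.
move=> fr ri; rewrite /lower_end fr; case/andP: fr => /eqP r2.
set h := (r %/ 4)%N => ah; have rE : r = (4 * h + 2)%N by rewrite /h; lia.
have [_ e2 e3] := act_cells ah; rewrite rE e2.
have xi : e (4 * h) + 2 <= x i.
  by have := cell_mono ri; have := cell i; rewrite rE e2; lra.
have [xi4|xi4] := ltrP (e (4 * h) + 4) (x i).
  by apply: hk_step_ge => j; rewrite neighboursE; lra.
apply: hk_step_ge_sum; rewrite -oppr_le0.
apply: (le_trans _ (puller_balance true ah)).
rewrite big_mkcond big_sumType /= opprD lerB //; last first.
  apply: ler_sum => s _.
  case: ifP => [/existsP[a /andP[/eqP gs /eqP sa]]|no].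
    have ps := puller_of_supercell ah gs sa; rewrite ifT; last first.
      by rewrite neighboursE /= ps /puller_right; lra.
    by rewrite ps /puller_right; lra.
  case: ifP => // sN.
  have [a [side [gs aa ps]]] := strategic_split_neighbour sN.
  have := supercell_puller side aa; rewrite -ps.
  move: sN; rewrite neighboursE /=; case: (ltngtP (supercell a) h) => ah'.
  - by have := supercell_lt ah'; lra.
  - by have := supercell_lt ah'; lra.
  move: ps; rewrite ah'; case: side gs => gs ps.
    by move/negbT/existsPn/(_ a): no; rewrite gs ah' !eqxx.
  by have [p _] := puller_leftP h; rewrite ps; lra.
rewrite -sumrN ler_sum // => j _; case: ifP => [jN|_]; last by case: ifP; lra.
have xj : x i - 1 <= x j <= x i + 1 by move: jN; rewrite neighboursE.
have := supercell_bounds j; case: ifP => [_|/eqP sj]; first by lra.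
case: (ltngtP (supercell j) h) => ah' //; have := supercell_lt ah'; lra.
Qed.

(** The mirror image, with threshold [puller_left h + 1/2]. An agent before the cut is more than 1
    away from the right pullers at [e (4 * h) + 3]. *)
Lemma left_of_forced r i : forced r -> (rho i < r)%N ->
  hk_step x split_place i < upper_end r.
Proof.
move=> fr ri; rewrite /upper_end fr; case/andP: fr => /eqP r2.
set h := (r %/ 4)%N => ah; have rE : r.-1 = (4 * h + 1)%N by rewrite /h; lia.
have [e1 _ e3] := act_cells ah; rewrite rE e1.
have [p xp] := puller_leftP h.
have ri' : (rho i <= r.-1)%N by lia.
have xi : x i < e (4 * h) + 2.
  by have := cell_mono ri'; have := cell i; rewrite rE e1; lra.
have {}xp := xp i xi.
apply: (@le_lt_trans _ _ (puller_left h + 2^-1)); last by lra.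
have [xi4|xi4] := ltrP (x i) (puller_left h - 1).
  by apply: hk_step_le => j; rewrite neighboursE; lra.
apply: hk_step_le_sum; rewrite (le_trans _ (puller_balance false ah)) //.
rewrite big_mkcond big_sumType /= lerD //; last first.
  rewrite -sumrN ler_sum // => s _.
  case: (boolP [exists a, _]) => [/existsP[a /andP[/eqP gs /eqP sa]]|no].
    have ps := puller_of_supercell ah gs sa; rewrite ifT; last first.
      by rewrite neighboursE /= ps; lra.
    by rewrite ps; lra.
  case: ifP => [sN|_]; last by lra.
  have [a [side [gs aa ps]]] := strategic_split_neighbour sN.
  have := supercell_puller side aa; rewrite -ps.
  move: sN; rewrite neighboursE /=; case: (ltngtP (supercell a) h) => ah'.
  - by have := supercell_lt ah'; lra.
  - by have := supercell_lt ah'; lra.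
  move: ps; rewrite ah'; case: side gs => gs ps; last first.
    by move/existsPn/(_ a): no; rewrite gs ah' !eqxx.
  by rewrite ps /puller_right; lra.
rewrite ler_sum // => j _; case: ifP => [jN|_]; last by case: ifP; lra.
have xj : x i - 1 <= x j <= x i + 1 by move: jN; rewrite neighboursE.
have := supercell_bounds j; case: ifP => [_|/eqP sj]; first by lra.
case: (ltngtP (supercell j) h) => ah' //; have := supercell_lt ah'; lra.
Qed.

(** At a boundary that is not a cut, the empty cell hides everything before it, so the average
    involves only cells from [r] on. *)
Lemma right_of_boundary r i : boundary r -> (r <= rho i)%N ->
  lower_end r <= hk_step x split_place i.
Proof.
have [fr _|/negbTE nfr] := boolP (forced r); first exact: right_of_forced.
rewrite /boundary /lower_end nfr orbF => br ri; apply: hk_step_ge => j jN.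
have [k ejk] := cell_of_neighbour jN; have [rk|kr] := leqP r k.
  by have := cell_mono rk; lra.
case/orP: br => [/eqP r0|er]; first by rewrite r0 in kr.
have kr' : (k <= r.-1)%N by lia.
have := cell_mono ri; have := cell i; have := cell_mono kr'.
have := e_step r.-1; rewrite prednK; last by lia.
case=> [er'|]; first by rewrite er' eqxx in er.
by move: jN; rewrite neighboursE; lra.
Qed.

Lemma left_of_boundary r i : boundary r -> (rho i < r)%N ->
  hk_step x split_place i < upper_end r.
Proof.
have [fr _|/negbTE nfr] := boolP (forced r); first exact: left_of_forced.
rewrite /boundary /upper_end nfr orbF => br ri; apply: hk_step_lt => j jN.
have [k ejk] := cell_of_neighbour jN; have [kr|rk] := leqP k r.-1.
  by have := cell_mono kr; lra.
case/orP: br => [/eqP r0|er]; first by rewrite r0 in ri.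
have ri' : (rho i <= r.-1)%N by lia.
have rk' : (r <= k)%N by lia.
have := cell_mono rk'; have := cell i; have := cell_mono ri'.
have := e_step r.-1; rewrite prednK; last by lia.
case=> [er'|]; first by rewrite er' eqxx in er.
by move: jN; rewrite neighboursE; lra.
Qed.

Lemma boundary_gap r : (0 < r)%N -> boundary r ->
  upper_end r + 1 <= lower_end r.
Proof.
move=> r0; rewrite /boundary /upper_end /lower_end.
have := e_step r.-1; rewrite (prednK r0) (gtn_eqF r0) /=.
by case: ifP => [_ [] | _ [->|]]; rewrite ?eqxx //; lra.
Qed.

Lemma lower_end_mono r r' : (r <= r')%N -> lower_end r <= lower_end r'.
Proof.
rewrite leq_eqVlt => /predU1P[-> //|/cell_lt].
by rewrite /lower_end; case: ifP; case: ifP; lra.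
Qed.

(** Cells without a boundary between them are contiguous, each of length 1; cuts at the ends only
    shorten the piece. *)
Lemma piece_length s r : (s < r)%N ->
  (forall t, (s < t < r)%N -> ~~ boundary t) ->
  upper_end r - lower_end s <= (r - s)%:R.
Proof.
move=> sr nb; have es k : (s + k < r)%N -> e (s + k) = e s + k%:R.
  elim: k => [|k IH] skr; first by rewrite addn0 addr0.
  have := nb (s + k.+1)%N; rewrite skr /boundary addnS /= -addnS => /(_ _).
  rewrite -{1}[s]addn0 ltn_add2l => /(_ isT); rewrite negb_or negbK.
  case/andP => /eqP -> _; rewrite IH; last by lia.
  by rewrite -addrA natr1.
have := es (r - s).-1; have -> : (s + (r - s).-1)%N = r.-1 by lia.
have -> : (r - s)%:R = (r - s).-1%:R + 1 :> R by rewrite natr1; congr _%:R; lia.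
move=> /(_ _)/wrap[]; first by lia.
by rewrite /upper_end /lower_end; case: ifP; case: ifP; lra.
Qed.

(** Either an empty cell interrupts the supercell, or the supercell is contiguous and its middle is
    cut. *)
Lemma boundary_of_supercell h : sel h ->
  exists2 r, boundary r & (4 * h < r <= 4 * h + 3)%N.
Proof.
move=> sh; have [b1|nb1] := boolP (boundary (4 * h + 1)%N).
  by exists (4 * h + 1)%N => //; lia.
have [b3|nb3] := boolP (boundary (4 * h + 3)%N).
  by exists (4 * h + 3)%N => //; lia.
exists (4 * h + 2)%N; last by lia.
move: nb1 nb3; rewrite /boundary !addn1 !addn2 !addn3 /= !negb_or !negbK.
case/andP => /eqP e1 _ /andP[/eqP e3 _].
have [//|ne2] := boolP (_ != _ :> R); move: ne2; rewrite negbK => /eqP e2.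
have f2 : forced (4 * h).+2.
  rewrite /forced; have -> : ((4 * h).+2 %% 4 = 2)%N by lia.
  have -> : ((4 * h).+2 %/ 4 = h)%N by lia.
  by rewrite eqxx /act sh /= addn3; apply/eqP; lra.
by rewrite f2.
Qed.

End Splitting.

(** * Consecutive boundaries *)

Section NextBoundary.
Variables (bd : pred nat) (D : nat).
Hypothesis bd0 : bd 0%N.
Hypothesis dense : forall c, exists r, bd r && (c < r <= c + D)%N.

Definition next_boundary c : nat := ex_minn (dense c).

Fixpoint last_boundary r : nat :=
  if bd r then r else if r is r'.+1 then last_boundary r' else 0%N.

Lemma next_boundaryP c :
  [/\ bd (next_boundary c), (c < next_boundary c <= c + D)%N
  & forall r, bd r -> (c < r)%N -> (next_boundary c <= r)%N].
Proof.
rewrite /next_boundary; case: ex_minnP => r /andP[br cr] min_r.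
split => // t bt ct.
have [tD|Dt] := leqP t (c + D); first by apply: min_r; rewrite bt ct.
by case/andP: cr => _ /leq_trans; apply; exact: ltnW.
Qed.

Lemma last_boundaryP r : [/\ bd (last_boundary r), (last_boundary r <= r)%N
  & forall b, bd b -> (b <= r)%N -> (b <= last_boundary r)%N].
Proof.
elim: r => [|r [IH1 IH2 IH3]] /=; first by rewrite bd0.
case: ifP => br; split => //; first exact: leqW.
move=> b bb; rewrite leq_eqVlt => /predU1P[bE|]; last exact: IH3.
by rewrite -bE bb in br.
Qed.

Lemma lt_next_last_boundary r : (r < next_boundary (last_boundary r))%N.
Proof.
have [bn /andP[ltn _] _] := next_boundaryP (last_boundary r).
have [_ _ maxp] := last_boundaryP r.
by rewrite ltnNge; apply/negP => /(maxp _ bn); rewrite leqNgt ltn.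
Qed.

(** Intervals from a boundary to the next are disjoint, and those starting in [[a, c]] fit between
    [a] and [next_boundary c]. *)
Lemma sum_next_boundary a c : (a <= c)%N ->
  (\sum_(a <= s < c.+1) (if bd s then next_boundary s - s else 0) + a
    <= next_boundary c)%N.
Proof.
move=> /subnKC <-; elim: (c - a)%N => [|k IH].
  rewrite addn0 big_nat1.
  by have [_ /andP[an _] _] := next_boundaryP a; case: ifP => _; lia.
rewrite addnS big_nat_recr /=; last by lia.
have [bn /andP[ltn _] _] := next_boundaryP (a + k).+1.
have [_ _ minn] := next_boundaryP (a + k).
have le1 : (next_boundary (a + k) <= next_boundary (a + k).+1)%N.
  by apply: minn => //; lia.
case: ifP => [bk|_]; last by lia.
have := minn _ bk (ltnSn _); lia.
Qed.

End NextBoundary.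

(** * Enumeration of cells, residue classes and windows *)

Lemma occupied_cells (R : realType) (n : nat) (x : 'I_n -> R) :
  exists (e : nat -> R) (rho : 'I_n -> nat),
    [/\ forall r, e r.+1 = e r + 1 \/ e r + 2 <= e r.+1,
        forall i, e (rho i) <= x i < e (rho i) + 1
      & forall i, (rho i < n)%N].
Proof.
pose s := sort <=%R (undup [seq Num.floor (x i) | i <- enum 'I_n]).
have s_lt : sorted <%R s.
  by rewrite lt_sorted_uniq_le sort_uniq undup_uniq sort_le_sorted.
have s_n : (size s <= n)%N.
  by rewrite size_sort (leq_trans (size_undup _)) // size_map size_enum_ord.
have s_x i : Num.floor (x i) \in s.
  by rewrite mem_sort mem_undup; apply/mapP; exists i; rewrite ?mem_enum.
(* Past the last occupied cell the enumeration continues with consecutive integers, which keeps the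
   step condition for all ranks. *)
pose E r : int := if (r < size s)%N then nth 0 s r else
  nth 0 s (size s).-1 + (r.+1 - size s)%:Z.
have E_lt r : E r + 1 <= E r.+1.
  rewrite /E; have [rs|sr] := ltnP r.+1 (size s).
    by rewrite (ltnW rs) lezD1 (lt_sorted_ltn_nth 0 s_lt) ?inE // ltnW.
  have [rs|sr'] := ltnP r (size s).
    have rE : r = (size s).-1 by lia.
    by rewrite -rE lerD2l; lia.
  by rewrite -addrA lerD2l; lia.
exists (fun r => (E r)%:~R), (fun i => index (Num.floor (x i)) s); split.
- move=> r; have : E r.+1 = E r + 1 \/ E r + 2 <= E r.+1.
    by have := E_lt r; lia.
  case=> [->|h]; [left|right]; first by rewrite intrD.
  by have := ler_int R (E r + 2) (E r.+1); rewrite h intrD.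
- move=> i; rewrite /E index_mem s_x nth_index //.
  by have := floor_itv (x i); rewrite intrD.
- by move=> i; rewrite (leq_trans _ s_n) ?index_mem.
Qed.

Lemma exists_upper_bound (R : realType) (n : nat) (f : 'I_n -> R) :
  exists c, forall i, f i <= c.
Proof. by exists (\big[Order.max/0]_i f i) => i; exact: le_bigmax. Qed.

(** Pigeonhole: if all [W] classes failed, then [W * (m + 1) <= 6 * n], against [6 * n <= W * m]. *)
Lemma sparse_residue (n m W : nat) (h : 'I_n -> nat) :
  (0 < n)%N -> (6 * n <= W * m)%N -> exists2 theta, (theta < W)%N &
    (6 * #|[set i | h i %% W == theta]%N| <= m)%N.
Proof.
move=> n0 nWm; have W0 : (0 < W)%N by case: W nWm => //; lia.
pose P (theta : 'I_W) := (6 * #|[set i | h i %% W == theta]%N| <= m)%N.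
have [/existsP[theta Ptheta]|/existsPn noP] := boolP [exists theta, P theta].
  by exists theta.
suff : (\sum_(theta < W) m.+1 <= 6 * n)%N.
  by rewrite sum_nat_const card_ord; lia.
have -> : (6 * n = \sum_(theta < W) 6 * #|[set i | h i %% W == theta]%N|)%N.
  rewrite -big_distrr /=; congr (_ * _)%N.
  under eq_bigr => theta _ do rewrite -sum1_card big_mkcond.
  rewrite exchange_big /= -{1}[n]card_ord -sum1_card; apply: eq_bigr => i _.
  rewrite (bigD1 (Ordinal (ltn_pmod (h i) W0))) //= inE eqxx big1 // => theta.
  by rewrite -val_eqE /= inE eq_sym => /negbTE ->.
by apply: leq_sum => theta _; rewrite ltnNge; exact: noP.
Qed.

Lemma sum_window (F : nat -> nat) (n l w : nat) : (0 < l)%N ->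
  (\sum_(b < n | b %/ l == w) F b <= \sum_(w * l <= s < w * l + l) F s)%N.
Proof.
move=> l0; rewrite -(big_mkord (fun b => b %/ l == w)%N F).
apply: (@leq_trans (\sum_(0 <= s < n + (w * l + l) | s %/ l == w) F s)%N).
  rewrite [leqRHS](big_cat_nat (leq0n n)) ?leq_addr //=; exact: leq_addr.
rewrite (big_cat_nat (leq0n (w * l))) /=; last by lia.
rewrite big_nat_cond big_pred0 => [|s]; last first.
  by apply/negbTE/negP => /andP[/andP[_ sw] /eqP wE]; have := leq_divM s l; lia.
rewrite (@big_cat_nat _ _ _ (w * l + l)%N) ?leq_addr ?leq_addl //=.
rewrite [X in (_ + (_ + X))%N]big_nat_cond.
rewrite [X in (_ + (_ + X))%N]big_pred0 => [|s].
  by rewrite addn0 add0n big_mkcond /=; apply: leq_sum => s _; case: ifP.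
apply/negbTE/negP => /andP[/andP[ws _] /eqP wE].
by have := ltn_ceil s l0; lia.
Qed.

(** * Splitting followed by contraction, with explicit constants *)

Lemma converged_within (R : realType) (n m W T : nat) (x0 : 'I_n -> R) :
  (0 < n)%N -> (3 <= m)%N -> (6 * n <= W * m)%N ->
  (12 * W * (m + 2 * n) <= m * T)%N ->
  exists ys : nat -> 'I_m -> R, converged (hk x0 ys T.+2).
Proof.
move=> n0 m3 nWm mT; have W0 : (0 < W)%N by case: W nWm {mT} => //; lia.
have [e [rho [e_step cell rho_n]]] := occupied_cells x0.
have [theta thetaW pop] := sparse_residue (fun i => rho i %/ 4)%N n0 nWm.
pose sel := (fun h => h %% W == theta)%N.
(* Three pullers for each of two sides: six per agent of a selected supercell, hence at most [m] by
   [pop]. *)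
pose d (j : 'I_n * bool) := if sel (supercell rho j.1) then 3%N else 0%N.
have dm : (\sum_j d j <= m)%N.
  apply: leq_trans pop.
  rewrite -(pair_bigA _ (fun a side => d (a, side))) /=.
  rewrite -sum1_card big_distrr /=.
  rewrite [leqRHS]big_mkcond /=; apply: leq_sum => a _.
  by rewrite big_bool /d /sel /supercell /= inE; case: ifP.
have [g gd] := assignment dm.
have [far0 far0P] := exists_upper_bound x0.
have farP i : x0 i + 1 < far0 + 2 by have := far0P i; lra.
have demand a side : sel (supercell rho a) ->
    (3 <= #|[set s | g s == Some (a, side)]|)%N.
  by move=> sa; have := gd (a, side); rewrite /d /= sa.
pose x1 := hk_step x0 (split_place x0 e rho sel g (far0 + 2)).
have right_x1 r i : boundary e sel r -> (r <= rho i)%N ->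
    lower_end e sel r <= x1 i.
  exact: right_of_boundary.
have left_x1 r i : boundary e sel r -> (rho i < r)%N ->
    x1 i < upper_end e sel r.
  exact: left_of_boundary.
have W4 : (0 < 4 * W)%N by lia.
have bd0 : boundary e sel 0 by [].
have dense c : exists r, boundary e sel r && (c < r <= c + 8 * W)%N.
  (* The selected supercell in the next period of [4 * W] ranks starts after [c] and ends before
     [c + 8 * W]. *)
  have sh : sel (W * (c %/ (4 * W)).+1 + theta)%N.
    by rewrite /sel mulnC modnMDl modn_small.
  have [r br r_h] := boundary_of_supercell e sh.
  exists r; rewrite br; have := divn_eq c (4 * W); have := ltn_pmod c W4.
  by move: (c %/ _)%N (c %% _)%N r_h => q t; nia.
pose nxt := next_boundary dense; pose prv := last_boundary (boundary e sel).
have prv_n i : (prv (rho i) < n)%N.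
  have [_ h _] := last_boundaryP bd0 (rho i).
  exact: leq_ltn_trans h (rho_n i).
(* A piece is named by the rank of its first cell. *)
pose lab i := Ordinal (prv_n i).
pose U (b : 'I_n) := upper_end e sel (nxt b).
pose L (b : 'I_n) := lower_end e sel b.
have hulls : in_hulls lab U L x1.
  move=> i; have [bp ple _] := last_boundaryP bd0 (rho i).
  have [bn _ _] := next_boundaryP dense (prv (rho i)).
  apply/andP; split; first exact: right_x1.
  by apply: left_x1 => //; exact: lt_next_last_boundary.
have sep : separated lab U L.
  move=> i j lij.
  have [bn /andP[ltn _] minn] := next_boundaryP dense (prv (rho i)).
  have [bj _ _] := last_boundaryP bd0 (rho j).
  have := boundary_gap e_step (leq_ltn_trans (leq0n _) ltn) bn.
  have := lower_end_mono sel e_step (minn _ bj lij).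
  rewrite /U /L /= -/(nxt _) -/(prv _); lra.
pose M := (n %/ (4 * W)).+1.
have blk_M (b : 'I_n) : (b %/ (4 * W) < M)%N.
  by rewrite ltnS leq_div2r // ltnW.
pose blk (b : 'I_n) := Ordinal (blk_M b).
pose pop2 (w : 'I_M) := #|[set i | blk (lab i) == w]|.
(* The added 1 rounds the proportional share up and gives every block a strategic agent. *)
pose d2 w := (1 + pop2 w * m %/ (2 * n))%N.
have sum_pop : (\sum_w pop2 w = n)%N.
  rewrite /pop2; under eq_bigr => w _ do rewrite -sum1_card big_mkcond.
  rewrite exchange_big /= -[RHS]card_ord -sum1_card; apply: eq_bigr => i _.
  rewrite (bigD1 (blk (lab i))) //= inE eqxx big1 // => w.
  by rewrite inE eq_sym => /negbTE ->.
have d2m : (\sum_w d2 w <= m)%N.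
  rewrite big_split /= sum1_card card_ord.
  have : (\sum_w pop2 w * m %/ (2 * n) * (2 * n) <= n * m)%N.
    rewrite -{3}sum_pop big_distrl /=; apply: leq_sum => w _.
    exact: leq_divM.
  rewrite -big_distrl /=; set S := (\sum_w _)%N => Sm.
  have := leq_divM n (4 * W); rewrite /M; set q := (n %/ _)%N => qn.
  (* There are [q + 1] blocks; with at most [m / 24] for [q] and [m / 2] for the shares, the total
     fits into [m]. *)
  have : (24 * q <= m)%N by nia.
  have : (2 * S <= m)%N by nia.
  lia.
have [asg asgP] := assignment d2m.
have [far2 far2P] := exists_upper_bound (fun i => U (lab i) + 1).
have mn0 : (0 : R) < m%:R + 2 * n%:R by rewrite -natrM -natrD ltr0n; lia.
(* If [k] agents get at least [k * m / (2 * n)] strategic ones, the strategic fraction of the block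
   is at least this. *)
pose sigma : R := m%:R / (m%:R + 2 * n%:R).
have sigma0 : 0 <= sigma by rewrite divr_ge0 // ltW.
have speed w : sigma *
    (#|[set i | blk (lab i) == w]| + #|[set s | asg s == Some w]|)%:R
    <= #|[set s | asg s == Some w]|%:R.
  rewrite /sigma mulrAC ler_pdivrMr // -natrM -natrM -natrD -natrM ler_nat.
  have := asgP w; rewrite /d2 -/(pop2 w); set k := #|_|.
  have := ltn_ceil (pop2 w * m) (d := 2 * n); nia.
have occ i : (0 < #|[set s | asg s == Some (blk (lab i))]|)%N.
  by apply: leq_trans (asgP _); rewrite /d2.
(* The pieces of a block start in a window of [4 * W] ranks, and the last one ends at most [8 * W]
   ranks later. *)
have lenF w : total_length lab blk U L w <= (12 * W)%:R.
  pose F s := if boundary e sel s then (nxt s - s)%N else 0%N.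
  apply: (@le_trans _ _ (\sum_(b < n | b %/ (4 * W) == w) F b)%N%:R).
    rewrite natr_sum /total_length big_mkcond [leRHS]big_mkcond /=.
    apply: ler_sum => b _.
    case: (boolP (used lab b)) => /= [/existsP[i /eqP <-]|_].
      rewrite -val_eqE /=; case: ifP => // _.
      have [bb _ _] := last_boundaryP bd0 (rho i).
      have [_ /andP[ltn _] minn] := next_boundaryP dense (lab i).
      rewrite /F /= bb; apply: piece_length => // t /andP[bt tn].
      by apply/negP => /minn /(_ bt); rewrite leqNgt tn.
    by case: ifP.
  rewrite ler_nat (leq_trans (sum_window _ _ _ W4)) //.
  have := sum_next_boundary bd0 dense (leq_addr (4 * W).-1 (w * (4 * W))).
  rewrite -/nxt -addnS prednK // => H.
  have [_ /andP[_ +] _] := next_boundaryP dense (w * (4 * W) + (4 * W).-1)%N.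
  rewrite -/(nxt _); rewrite /F; move: H; set S := (\sum_(_ <= _ < _) _)%N; lia.
have sT : (12 * W)%:R <= sigma * T%:R.
  rewrite /sigma mulrAC ler_pdivlMr //.
  by rewrite -!natrM -natrD -natrM ler_nat.
have [ys ysP] := contraction far2P sigma0 speed occ hulls sep lenF sT.
exists (fun t => if t is t'.+1 then ys t' else
  split_place x0 e rho sel g (far0 + 2)).
by rewrite hkS.
Qed.

Lemma optimal_time_le (R : realType) (n m : nat) : (0 < n)%N -> (3 <= m)%N ->
  (m <= 13 * n)%N -> (f R n m <= (4000 * (n%:R / m%:R) ^+ 2)%:E)%E.
Proof.
move=> n0 m3 mn; have m0 : (0 < m)%N by lia.
pose W := (6 * n %/ m).+1; pose T := (12 * W * (m + 2 * n) %/ m).+1.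
have nWm : (6 * n <= W * m)%N by exact/ltnW/ltn_ceil.
have mT : (12 * W * (m + 2 * n) <= m * T)%N.
  by rewrite [leqRHS]mulnC; exact/ltnW/ltn_ceil.
apply: ge_ereal_sup => _ [x0 _ <-].
have [ys ysP] := converged_within x0 n0 m3 nWm mT.
apply: (@le_trans _ _ (T.+2%:R%:E)).
  apply: ge_ereal_inf; exists (convergence_time x0 ys); first by exists ys.
  by apply: ge_ereal_inf; exists (T.+2%:R%:E) => //; exists T.+2.
rewrite lee_fin; set r := _ / _.
have m0' : 0 < m%:R :> R by rewrite ltr0n.
have rm : n%:R = r * m%:R by rewrite /r divfK // gt_eqF.
(* This absorbs additive constants: [W <= 6 * r + 1 <= 19 * r] and [1 + 2 * r <= 15 * r]. *)
have r13 : 1 <= 13 * r.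
  by rewrite /r mulrA ler_pdivlMr // mul1r -natrM ler_nat.
have W_r : W%:R <= 19 * r.
  have : ((6 * n %/ m) * m)%:R <= (6 * n)%:R :> R by rewrite ler_nat leq_divM.
  rewrite !natrM rm mulrA ler_pM2r // /W -natr1; lra.
have T_r : T%:R <= 12 * W%:R * (1 + 2 * r) + 1.
  have : ((12 * W * (m + 2 * n) %/ m) * m)%:R <= (12 * W * (m + 2 * n))%:R :> R.
    by rewrite ler_nat leq_divM.
  rewrite !(natrM, natrD) rm mulrA -[X in _ + X]mulrA.
  have -> : 12 * W%:R * (m%:R + 2 * (r * m%:R)) =
     12 * W%:R * (1 + 2 * r) * m%:R by ring.
  by rewrite ler_pM2r // /T -natr1; lra.
have WW : W%:R * (1 + 2 * r) <= 19 * r * (15 * r).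
  by apply: ler_pM => //; lra.
have rr : 1 <= 169 * (r * r) by nra.
(* The total coefficient is [12 * 19 * 15 + 3 * 169 = 3927], below 4000. *)
by rewrite -[T.+2]addn2 natrD expr2; nra.
Qed.

Theorem theorem17 (R : realType) (alpha : R)
    (alpha_ge0 : 0 <= alpha) (alpha_le1 : alpha <= 1) :
  exists2 C : R, 0 < C &
    exists n0 : nat, forall n : nat, (n0 <= n)%N ->
      (f R n (Num.truncn (n%:R `^ alpha) + 12)
        <= (C * n%:R `^ (2 - 2 * alpha))%:E)%E.
Proof.
exists 4000; first by rewrite ltr0n.
exists 1%N => n n0; set m := (_ + 12)%N.
have n1 : 1 <= n%:R :> R by rewrite ler1n.
have nm : n%:R `^ alpha <= m%:R :> R.
  have := truncnS_gt (n%:R `^ alpha : R).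
  by rewrite /m natrD -natr1; lra.
(* Since [alpha <= 1], [m] is at most [n + 12], and [n + 12 <= 13 * n] for [n >= 1]. *)
have mn : (m <= 13 * n)%N.
  have : (Num.truncn (n%:R `^ alpha : R) <= n)%N.
    rewrite -(natrK (R := R) n) le_truncn // natrK -[leRHS]powRr1 ?ler0n //.
    exact: ler_powR.
  by rewrite /m; lia.
have m3 : (3 <= m)%N by rewrite /m addnC.
apply: le_trans (optimal_time_le R n0 m3 mn) _; rewrite lee_fin.
rewrite (ler_wpM2l (ler0n R 4000)) //.
have m0 : 0 < m%:R :> R by rewrite ltr0n; lia.
have n0' : 0 < n%:R `^ alpha :> R by rewrite powR_gt0 // ltr0n.
(* The target becomes the square of [n ^ (1 - alpha)], which dominates [n / m] by [nm]. *)
have -> : 2 - 2 * alpha = (1 - alpha) * 2%:R by ring.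
rewrite powRrM powR_mulrn ?powR_ge0 //.
apply: lerXn2r; rewrite ?nnegrE ?powR_ge0 ?divr_ge0 ?ler0n //.
rewrite powRB; last by rewrite pnatr_eq0 -lt0n n0 implybT.
by rewrite powRr1 ?ler0n // ler_wpM2l ?ler0n // lef_pV2 ?posrE.
Qed.
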